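(* Let $\mathcal{I}(\mathcal{D},\mathcal{P},\mathcal{A})$ be a two-sender unicast index coding problem with an eavesdropper, belonging to Case II-B, i.e. all four interactions $\mathcal{D}_1\rightarrow\mathcal{D}_{\{1,2\}}$, $\mathcal{D}_{\{1,2\}}\rightarrow\mathcal{D}_1$, $\mathcal{D}_2\rightarrow\mathcal{D}_{\{1,2\}}$, $\mathcal{D}_{\{1,2\}}\rightarrow\mathcal{D}_2$ exist (with arbitrary interactions between $\mathcal{D}_1$ and $\mathcal{D}_2$), and suppose these four interactions are fully-participated. If weakly secure linear index codes exist for the single-sender problems $\mathcal{I}(\mathcal{D}_{\mathcal{T}},\mathcal{A}_{\mathcal{T}})$ for all non-empty $\mathcal{T}\subseteq\{1,2\}$, then the optimal codelength $l^*=l^*(\mathcal{I}(\mathcal{D},\mathcal{P},\mathcal{A}))$ satisfies $$l^*\le\max\{l^*_{\{1,2\}},\,l^*_1+l^*_2\}.$$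
   Context: Fix a finite field $\mathbb{F}_q$ and messages $\mathcal{M}=\{x_1,\dots,x_m\}$, $x_i\in\mathbb{F}_q$; $x_i$ is a realization of a random variable $X_i$, and the $X_i$ are independent and uniform on $\mathbb{F}_q$. There are $m$ receivers; receiver $i$ demands $x_i$ and has side-information $\mathcal{K}_i\subseteq\mathcal{M}\setminus\{x_i\}$. The side-information digraph $\mathcal{D}$ has vertices $v_1,\dots,v_m$ and an edge $(v_i,v_j)$ iff $x_j\in\mathcal{K}_i$. For $\mathcal{B}\subseteq[m]=\{1,\dots,m\}$ put $x_{\mathcal{B}}=\{x_i:i\in\mathcal{B}\}$. Single-sender problem $\mathcal{I}(\mathcal{D},\mathcal{A})$: one sender knows all messages and transmits $\mathbf{G}\mathbf{x}$, $\mathbf{G}\in\mathbb{F}_q^{l\times m}$, $\mathbf{x}=(x_1,\dots,x_m)^T$; this is a linear index code of length $l$ if every receiver $i$ can recover $x_i$ from $\mathbf{G}\mathbf{x}$ and $\mathcal{K}_i$. An eavesdropper knows $x_{\mathcal{A}}$ and $\mathbf{G}\mathbf{x}$. The code is weakly secure if $H(X_i\mid\mathbf{G}\mathbf{X},X_{\mathcal{A}})=H(X_i)$ for every message index $i\notin\mathcal{A}$. Two-sender problem $\mathcal{I}(\mathcal{D},\mathcal{P},\mathcal{A})$: sender $\mathcal{S}_j$ knows $\mathcal{M}_j\subseteq\mathcal{M}$, $j\in\{1,2\}$, with $\mathcal{M}_1\cup\mathcal{M}_2=\mathcal{M}$. Put $\mathcal{P}_1=\mathcal{M}_1\setminus\mathcal{M}_2$,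 $\mathcal{P}_2=\mathcal{M}_2\setminus\mathcal{M}_1$, $\mathcal{P}_{\{1,2\}}=\mathcal{M}_1\cap\mathcal{M}_2$, $\mathcal{P}=(\mathcal{P}_1,\mathcal{P}_2,\mathcal{P}_{\{1,2\}})$. Singletons are written without braces: the non-empty $\mathcal{T}\subseteq\{1,2\}$ are $1,2,\{1,2\}$. A linear two-sender index code consists of linear codewords $\mathbf{c}_1,\mathbf{c}_2$ over $\mathbb{F}_q$ of lengths $l_1,l_2$, where $\mathbf{c}_j$ (sent by $\mathcal{S}_j$) is a linear function of the messages in $\mathcal{M}_j$ only, such that each receiver $i$ can recover $x_i$ from $\mathbf{c}_1,\mathbf{c}_2,\mathcal{K}_i$. Its length is $l_1+l_2$. An eavesdropper knows $x_{\mathcal{A}}$, $\mathcal{A}\subsetneq[m]$, and $\mathbf{c}_1,\mathbf{c}_2$; the code is weakly secure if $H(X_i\mid\mathbf{c}_1,\mathbf{c}_2,X_{\mathcal{A}})=H(X_i)$ for all $i\in[m]\setminus\mathcal{A}$. For non-empty $\mathcal{T}\subseteq\{1,2\}$, $\mathcal{D}_{\mathcal{T}}$ is the sub-digraph of $\mathcal{D}$ induced by $\{v_j:x_j\in\mathcal{P}_{\mathcal{T}}\}$ (the problem with messages and receivers restricted to $\mathcal{P}_{\mathcal{T}}$, side-information $\mathcal{K}_i\cap\mathcal{P}_{\mathcal{T}}$), and $\mathcal{A}_{\mathcal{T}}$ is the set of $i\in\mathcal{A}$ with $x_i\in\mathcal{P}_{\mathcal{T}}$. $l^*(\cdot)$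 denotes the minimum length over $\mathbb{F}_q$ of a weakly secure linear index code for the given problem, and $l^*_{\mathcal{T}}=l^*(\mathcal{I}(\mathcal{D}_{\mathcal{T}},\mathcal{A}_{\mathcal{T}}))$. For $\mathcal{T}\ne\mathcal{T}'$, the interaction $\mathcal{D}_{\mathcal{T}}\rightarrow\mathcal{D}_{\mathcal{T}'}$ exists if $\mathcal{D}$ has an edge from some vertex of $\mathcal{D}_{\mathcal{T}}$ to some vertex of $\mathcal{D}_{\mathcal{T}'}$; it is fully-participated if there are edges from every vertex of $\mathcal{D}_{\mathcal{T}}$ to every vertex of $\mathcal{D}_{\mathcal{T}'}$. *)

(* Defs.v *)
From mathcomp Require Import all_boot all_order all_algebra.
From mathcomp Require Import all_classical all_reals all_analysis.

Set Implicit Arguments.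
Unset Strict Implicit.
Unset Printing Implicit Defensive.

Import Order.TTheory GRing.Theory Num.Theory.

Local Open Scope ring_scope.

Section Entropy.
Context {R : realType} {d : measure_display} {T : measurableType d}.
Variable P : probability T R.

(* The alphabets carry no sigma-algebra: a finitely valued random variable is
   a function with measurable fibres. *)
Definition pmass (V : eqType) (U : T -> V) (v : V) : R :=
  fine (P [set w | U w = v]%classic).

(* Entropies are in nats. *)
Definition entropy (V : finType) (U : T -> V) : R :=
  - \sum_(v : V) pmass U v * ln (pmass U v).

(* H(U | W) = - sum_(u, w) p(u, w) log (p(u, w) / p(w)); terms with
   p(u, w) = 0 vanish. *)
Definition cond_entropy (V V' : finType) (U : T -> V) (W : T -> V') : R :=
  - \sum_(u : V) \sum_(w : V')
      let puw := pmass (fun t => (U t, W t)) (u, w) in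
      puw * ln (puw / pmass W w).

Definition mutually_independent (I : finType) (V : eqType) (X : I -> T -> V) :=
  forall (J : {set I}) (x : I -> V),
    fine (P [set w | forall i, i \in J -> X i w = x i]%classic)
      = \prod_(i in J) pmass (X i) (x i).

Definition iid_uniform (F : finType) (I : finType) (X : I -> T -> F) :=
  [/\ forall i a, measurable [set w | X i w = a]%classic,
      forall i a, pmass (X i) a = (#|F|%:R)^-1
    & mutually_independent X].

End Entropy.

(* The subvector x_B, its entries being listed in increasing index order. *)
Definition subvec (F : Type) (m : nat) (B : {set 'I_m}) (x : 'cV[F]_m) :
    'cV[F]_#|B| :=
  rowsub (fun k : 'I_#|B| => enum_val k) x.

(* A problem with messages and receivers indexed by 'I_m is given by the
   side-information sets K i, i.e. the out-neighbourhoods of the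
   side-information digraph, and by the set A of messages known to the
   eavesdropper.  An encoder maps the message vector to everything that is
   transmitted, by one or two senders. *)
Section IndexCodes.
Context {R : realType} {d : measure_display} {T : measurableType d}.
Variable P : probability T R.
Variable F : finFieldType.

Definition decodable (m : nat) (K : 'I_m -> {set 'I_m}) (V : Type)
    (enc : 'cV[F]_m -> V) :=
  forall i : 'I_m, exists dec : V -> 'cV[F]_#|K i| -> F,
    forall x : 'cV[F]_m, dec (enc x) (subvec (K i) x) = x i ord0.

Definition message_vector (m : nat) (X : 'I_m -> T -> F) (w : T) : 'cV[F]_m :=
  \col_i X i w.

Definition weakly_secure (m : nat) (X : 'I_m -> T -> F) (A : {set 'I_m})
    (V : finType) (enc : 'cV[F]_m -> V) :=
  forall i : 'I_m, i \notin A ->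
    cond_entropy P (X i)
      (fun w => (enc (message_vector X w), subvec A (message_vector X w)))
    = entropy P (X i).

Definition secure_code_of_length (m : nat) (X : 'I_m -> T -> F)
    (K : 'I_m -> {set 'I_m}) (A : {set 'I_m}) (l : nat) :=
  exists G : 'M[F]_(l, m),
    let enc x := G *m x in decodable K enc /\ weakly_secure X A enc.

(* Sender j knows the messages in Mj only, so its codeword is a linear
   function of the corresponding subvector. *)
Definition secure_two_sender_code_of_length (m : nat) (X : 'I_m -> T -> F)
    (K : 'I_m -> {set 'I_m}) (M1 M2 : {set 'I_m}) (A : {set 'I_m}) (l : nat) :=
  exists (l1 l2 : nat) (G1 : 'M[F]_(l1, #|M1|)) (G2 : 'M[F]_(l2, #|M2|)),
    let enc x := (G1 *m subvec M1 x, G2 *m subvec M2 x) in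
    [/\ l = (l1 + l2)%N, decodable K enc & weakly_secure X A enc].

(* The existence statement for the problem restricted to the messages and
   receivers in S, relabelled by 'I_#|S|. *)
Definition secure_subcode_of_length (m : nat) (X : 'I_m -> T -> F)
    (K : 'I_m -> {set 'I_m}) (A S : {set 'I_m}) (l : nat) :=
  secure_code_of_length
    (fun k : 'I_#|S| => X (enum_val k))
    (fun k : 'I_#|S| => [set k' : 'I_#|S| | enum_val k' \in K (enum_val k)])
    [set k : 'I_#|S| | enum_val k \in A] l.

End IndexCodes.

Lemma asbool_exists (Q : nat -> Prop) :
  (exists l, Q l) -> exists l, `[< Q l >].
Proof. by move=> [l Ql]; exists l; apply/asboolP. Qed.

(* The least l such that Q l; used for the optimal codelength l^*. *)
Definition min_length (Q : nat -> Prop) (exQ : exists l, Q l) : nat :=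
  ex_minn (asbool_exists exQ).

Definition interaction_exists (m : nat) (K : 'I_m -> {set 'I_m})
    (S S' : {set 'I_m}) :=
  exists i j, [/\ i \in S, j \in S' & j \in K i].

Definition fully_participated (m : nat) (K : 'I_m -> {set 'I_m})
    (S S' : {set 'I_m}) :=
  forall i j, i \in S -> j \in S' -> j \in K i.

(* The interactions between the parts of messages known to one sender only
   are arbitrary. *)
Definition case_II_B (m : nat) (K : 'I_m -> {set 'I_m})
    (P1 P2 P12 : {set 'I_m}) :=
  [/\ interaction_exists K P1 P12, interaction_exists K P12 P1,
      interaction_exists K P2 P12 & interaction_exists K P12 P2].

(* Main.v *)
Require Import Defs.
From mathcomp Require Import all_boot all_order all_algebra.
From mathcomp Require Import all_classical all_reals all_analysis.

(** For a linear code the security of message [i] is witnessed by one vector: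
    either some [z] with [z_i = 1] has zero codeword and vanishes on [A], and
    then translating by the multiples of [z] shows that [X_i] is uniform given
    the eavesdropper's view; or there is no such [z], and then [X_i] is a
    function of that view, so that its conditional entropy is [0].

    Pad the three optimal codes so that the lengths satisfy
    [l12 = l1 + l2 = max (l12, l1 + l2)].  Sender 1 adds the first [l1] entries
    of the codeword of [P12] to the codeword of [P1], and sender 2 adds the
    remaining ones to the codeword of [P2].  By full participation a receiver in
    [P1] or [P2] can cancel the contribution of [P12], and a receiver in [P12]
    those of [P1] and [P2].  A witness of security of one of the three codes,
    extended by [0], is a witness for the two-sender code. *)

Set Implicit Arguments.
Unset Strict Implicit.
Unset Printing Implicit Defensive.

Import Order.TTheory GRing.Theory Num.Theory.

Local Open Scope ring_scope.

(** * Restriction and zero extension of message vectors *)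

Section Subvectors.
Variables (F : finFieldType) (m : nat).
Implicit Types (B C : {set 'I_m}) (x y z : 'cV[F]_m).

Lemma subvecE B x k : subvec B x k ord0 = x (enum_val k) ord0.
Proof. by rewrite mxE. Qed.

Lemma subvecB B x y : subvec B (x - y) = subvec B x - subvec B y.
Proof. by apply/colP => k; rewrite !mxE. Qed.

Lemma eq_subvec B x y :
  subvec B x = subvec B y <-> forall j, j \in B -> x j ord0 = y j ord0.
Proof.
split=> [/colP e j jB | e]; last by apply/colP => k; rewrite !mxE e ?enum_valP.
by have := e (enum_rank_in jB j); rewrite !subvecE enum_rankK_in.
Qed.

Lemma subvec_eq0 B z : subvec B z = 0 <-> forall j, j \in B -> z j ord0 = 0.
Proof.
have -> : 0 = subvec B (0 : 'cV[F]_m) by apply/colP => k; rewrite !mxE.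
by rewrite eq_subvec; split=> e j /e; rewrite mxE.
Qed.

(** Turns a matrix acting on the messages of a part [B] into one acting on all the messages [C] of a
    sender. *)
Definition reselect B C : 'M[F]_(#|B|, #|C|) :=
  \matrix_(k, k') (enum_val k == enum_val k')%:R.

Lemma reselectE B C x :
  B \subset C -> reselect B C *m subvec C x = subvec B x.
Proof.
move=> /fintype.subsetP BC; apply/colP => k; rewrite !mxE.
have kC := BC _ (enum_valP k).
rewrite (bigD1 (enum_rank_in kC (enum_val k))) //= big1 => [|k' k'N].
  by rewrite addr0 !mxE enum_rankK_in // eqxx mul1r.
rewrite !mxE.
case: eqP => [e|_]; last by rewrite mul0r.
by case/eqP: k'N; apply: enum_val_inj; rewrite enum_rankK_in.
Qed.

(** By injectivity of [enum_val] the sum has at most one term; it is empty, hence 0, outside [B]. *)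
Definition extend0 B (z : 'cV[F]_#|B|) : 'cV[F]_m :=
  \col_j \sum_(k | enum_val k == j) z k ord0.

Lemma extend0E B (z : 'cV[F]_#|B|) k : extend0 z (enum_val k) ord0 = z k ord0.
Proof.
by rewrite mxE (eq_bigl (pred1 k)) ?big_pred1_eq // => k'; rewrite (inj_eq enum_val_inj).
Qed.

Lemma extend0_out B (z : 'cV[F]_#|B|) j : j \notin B -> extend0 z j ord0 = 0.
Proof.
move=> jB; rewrite mxE big_pred0 // => k; apply/eqP => e.
by rewrite -e enum_valP in jB.
Qed.

Lemma subvec_extend0 B (z : 'cV[F]_#|B|) : subvec B (extend0 z) = z.
Proof. by apply/colP => k; rewrite subvecE extend0E. Qed.

Lemma subvec_extend0_disjoint B C (z : 'cV[F]_#|B|) :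
  [disjoint B & C] -> subvec C (extend0 z) = 0.
Proof.
move=> BC; apply/subvec_eq0 => j jC; apply: extend0_out.
by rewrite (disjointFl BC jC).
Qed.

Lemma decodableP (K : 'I_m -> {set 'I_m}) (V : Type) (enc : 'cV[F]_m -> V) :
  decodable K enc <->
  forall i x y, enc x = enc y -> subvec (K i) x = subvec (K i) y ->
    x i ord0 = y i ord0.
Proof.
split=> [dec i x y e1 e2 | inj i].
  by have [f fE] := dec i; rewrite -!fE e1 e2.
(* The decoder chooses any message vector compatible with [c] and [s]; its value 0 on incompatible
   pairs is never met. *)
exists (fun c s => if pselect (exists x, enc x = c /\ subvec (K i) x = s) is left ex
                   then projT1 (cid ex) i ord0 else 0) => x.
case: pselect => [ex|[]]; last by exists x.
by case: (cid ex) => y /= [e1 e2]; apply: inj.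
Qed.

End Subvectors.

(** * Conditional entropy in the two extreme cases *)

Section Entropy.
Context {R : realType} {d : measure_display} {T : measurableType d}.
Variable P : probability T R.

(** In each term either [u = f w], where the quotient inside the logarithm is 1 or the factor is 0,
    or the joint event is empty. *)
Lemma cond_entropy_determined (V V' : finType) (W : T -> V') (f : V' -> V) :
  cond_entropy P (f \o W) W = 0.
Proof.
rewrite /cond_entropy big1 ?oppr0 // => u _; rewrite big1 // => w _ /=.
have [fw|fwu] := eqVneq (f w) u.
  have -> : pmass P (fun t => (f (W t), W t)) (u, w) = pmass P W w.
    rewrite /pmass; congr (fine (P _)); apply/seteqP; split=> t /=; first by case.
    by move=> Wt; rewrite Wt fw.
  have [->|p0] := eqVneq (pmass P W w) 0; first by rewrite mul0r.
  by rewrite divff // ln1 mulr0.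
suff -> : pmass P (fun t => (f (W t), W t)) (u, w) = 0 by rewrite mul0r.
rewrite /pmass (_ : [set _ | _]%classic = set0) ?measure0 //.
by apply/seteqP; split=> t //= [e1 e2]; move: fwu; rewrite -e1 -e2 eqxx.
Qed.

Lemma entropy_uniform (V : finType) (U : T -> V) :
  (0 < #|V|)%N -> (forall v, pmass P U v = #|V|%:R^-1) ->
  entropy P U = ln #|V|%:R.
Proof.
move=> V0 unif; rewrite /entropy.
under eq_bigr do rewrite unif.
rewrite sumr_const lnV ?posrE ?ltr0n // mulrN mulNrn opprK -[LHS]mulr_natl mulrA.
by rewrite divff ?mul1r // pnatr_eq0 -lt0n.
Qed.

(** Each term is the mass of [w] times a constant, so only the total mass of [W] enters. *)
Lemma cond_entropy_uniform (V V' : finType) (U : T -> V) (W : T -> V') :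
  (0 < #|V|)%N -> \sum_w pmass P W w = 1 ->
  (forall u w, pmass P (fun t => (U t, W t)) (u, w) = pmass P W w / #|V|%:R) ->
  cond_entropy P U W = ln #|V|%:R.
Proof.
move=> V0 W1 unif; rewrite /cond_entropy.
have nV : #|V|%:R != 0 :> R by rewrite pnatr_eq0 -lt0n.
have term u w : let puw := pmass P (fun t => (U t, W t)) (u, w) in
    puw * ln (puw / pmass P W w) = pmass P W w * (- (ln #|V|%:R / #|V|%:R)).
  rewrite /= unif; have [->|p0] := eqVneq (pmass P W w) 0; first by rewrite !mul0r.
  rewrite [X in ln X]mulrAC divff // mul1r lnV ?posrE ?ltr0n //.
  by rewrite mulrN mulrAC mulrN mulrA.
under eq_bigr => u _ do under eq_bigr => w _ do rewrite term.
under eq_bigr => u _ do rewrite -mulr_suml W1 mul1r.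
by rewrite sumr_const mulNrn opprK -[LHS]mulr_natl mulrCA divff // mulr1.
Qed.

End Entropy.

(** * Uniform message vectors: masses as counts *)

Section Uniform.
Context {R : realType} {d : measure_display} {T : measurableType d}.
Variables (P : probability T R) (F : finFieldType) (m : nat).
Variables (X : 'I_m -> T -> F) (hX : iid_uniform P X).

Lemma measurable_message_vector (x : 'cV[F]_m) :
  measurable [set w | message_vector X w = x]%classic.
Proof.
have [mX _ _] := hX.
rewrite (_ : [set _ | _]%classic =
  (\bigcap_(i in [set: 'I_m]) [set w | X i w = x i ord0])%classic).
  apply: fin_bigcap_measurable => // i _; exact: mX.
apply/seteqP; split=> w /=.
  by move=> <- i _ /=; rewrite mxE.
by move=> e; apply/colP => i; rewrite mxE; apply: e.
Qed.

Lemma pmass_message_vector (x : 'cV[F]_m) :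
  pmass P (message_vector X) x = (#|F|%:R ^+ m)^-1.
Proof.
have [_ uX indX] := hX.
have := indX [set: 'I_m] (fun i => x i ord0).
under eq_bigr do rewrite uX.
rewrite prodr_const cardsT card_ord exprVn => <-.
rewrite /pmass; congr (fine (P _)); apply/seteqP; split=> w /=.
  by move=> <- i _; rewrite mxE.
by move=> e; apply/colP => i; rewrite mxE; apply: e; rewrite inE.
Qed.

(** The event is a finite disjoint union of fibres of the message vector, each of the same mass. *)
Lemma pmass_comp_message_vector (V : eqType) (h : 'cV[F]_m -> V) v :
  pmass P (fun w => h (message_vector X w)) v =
  \sum_(x | h x == v) (#|F|%:R ^+ m)^-1.
Proof.
have fin x : P [set w | message_vector X w = x]%classic =
    ((#|F|%:R ^+ m)^-1)%:E.
  rewrite -(pmass_message_vector x) /pmass fineK //.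
  exact/fin_num_measure/measurable_message_vector.
rewrite /pmass (_ : [set _ | _]%classic =
  (\bigcup_(x in [set` enum [pred x | h x == v]])
     [set w | message_vector X w = x])%classic); last first.
  apply/seteqP; split=> w /=.
    by move=> e; exists (message_vector X w) => //=; rewrite mem_enum inE e.
  by case=> x /=; rewrite mem_enum inE => /eqP e ->.
rewrite measure_fin_bigcup.
- rewrite (eq_fsbigr (fun=> ((#|F|%:R ^+ m)^-1)%:E)); last by move=> x _; apply: fin.
  rewrite -fsbig_seq ?enum_uniq // sumEFin /= big_enum_cond /=.
  by apply: eq_bigl => x; rewrite andbT.
- exact: finite_seq.
- by move=> x y _ _ [w /= [<- <-]].
- by move=> x _; apply: measurable_message_vector.
Qed.

Lemma sum_pmass_comp_message_vector (V : finType) (h : 'cV[F]_m -> V) :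
  \sum_v pmass P (fun w => h (message_vector X w)) v = 1.
Proof.
under eq_bigr do rewrite pmass_comp_message_vector.
have -> : \sum_v \sum_(x | h x == v) (#|F|%:R ^+ m)^-1 =
    \sum_(x : 'cV[F]_m) (#|F|%:R ^+ m)^-1 :> R.
  by rewrite [RHS](partition_big h xpredT).
rewrite sumr_const card_mx muln1 -natrX.
rewrite -[LHS]mulr_natl divff // pnatr_eq0 -lt0n expn_gt0.
by rewrite (cardD1 0).
Qed.

Lemma witness_weakly_secure (A : {set 'I_m}) (V : finType) (enc : 'cV[F]_m -> V) :
  (forall i, i \notin A -> exists z,
     [/\ forall a x, enc (x + a *: z) = enc x, subvec A z = 0 & z i ord0 = 1]) ->
  weakly_secure P X A enc.
Proof.
move=> wit i iA; have [z [encz Az zi]] := wit i iA.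
have F0 : (0 < #|F|)%N by rewrite (cardD1 0).
(* The eavesdropper's view, invariant under translation by multiples of [z]. *)
pose h x := (enc x, subvec A x).
have hz a x : h (x + a *: z) = h x.
  congr pair => //; apply/eq_subvec => j jA; rewrite !mxE.
  by move/subvec_eq0: Az => -> //; rewrite mulr0 addr0.
have [_ uX _] := hX.
rewrite (entropy_uniform F0 (uX i)); apply: cond_entropy_uniform => //.
  exact: (sum_pmass_comp_message_vector h).
move=> u v.
pose n u' := \sum_(x : 'cV[F]_m | (x i ord0, h x) == (u', v)) (#|F|%:R ^+ m)^-1 : R.
have pn u' : pmass P (fun w => (X i w, h (message_vector X w))) (u', v) = n u'.
  rewrite -[RHS](pmass_comp_message_vector (fun x => (x i ord0, h x)) (u', v)).
  by rewrite /pmass; congr (fine (P _)); apply/seteqP; split=> w /=; rewrite mxE.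
have nu u' : n u' = n u.
  (* This translation carries the vectors with [i]-th entry [u] and view [v] onto those with [i]-th
     entry [u'] and view [v]. *)
  rewrite /n (reindex (fun x => x + (u' - u) *: z)) /=.
    apply: eq_bigl => x; rewrite hz !xpair_eqE; congr andb.
    by rewrite !mxE zi mulr1 -[u' - u]opprB subr_eq [u' + _]addrC subrK.
  exists (fun x => x - (u' - u) *: z) => x _; [exact: addrK | exact: subrK].
(* The fibre of the view splits by the value of the [i]-th entry into [#|F|] pieces of equal
   mass. *)
have -> : pmass P (fun w => h (message_vector X w)) v = #|F|%:R * n u.
  rewrite pmass_comp_message_vector (partition_big (fun x : 'cV[F]_m => x i ord0) xpredT) //=.
  rewrite mulr_natl -[RHS]sumr_const; apply: eq_bigr => u' _.
  by rewrite -(nu u'); apply: eq_bigl => x; rewrite xpair_eqE andbC.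
by rewrite pn mulrAC divff ?mul1r // pnatr_eq0 -lt0n.
Qed.

End Uniform.

(** * From security of a linear code to witnesses *)

Section LinearCodes.
Context {R : realType} {d : measure_display} {T : measurableType d}.
Variables (P : probability T R) (F : finFieldType) (m : nat).
Variables (X : 'I_m -> T -> F).
Hypothesis uX : forall i a, pmass P (X i) a = #|F|%:R^-1.

Lemma weakly_secure_witness (A : {set 'I_m}) l (G : 'M[F]_(l, m)) :
  weakly_secure P X A (mulmx G) -> forall i, i \notin A ->
  exists z, [/\ G *m z = 0, subvec A z = 0 & z i ord0 = 1].
Proof.
move=> sec i iA; apply: contrapT => nowit.
(* Otherwise dividing [z] by its [i]-th entry would give a witness. *)
have {}nowit z : G *m z = 0 -> subvec A z = 0 -> z i ord0 = 0.
  move=> Gz Az; apply/eqP/negP => /negP zi; apply: nowit.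
  exists ((z i ord0)^-1 *: z); split; last by rewrite mxE mulVf.
    by rewrite -scalemxAr Gz scaler0.
  by apply/subvec_eq0 => j jA; rewrite mxE (iffLR (subvec_eq0 _ _) Az _ jA) mulr0.
pose h x := (G *m x, subvec A x).
(* Two vectors with the same view differ by one to which [nowit] applies, so any preimage of [v]
   gives the same [i]-th entry. *)
pose f v := if [pick x | h x == v] is Some x then x i ord0 else 0.
have fh x : f (h x) = x i ord0.
  rewrite /f; case: pickP => [y /eqP[Gyx Ayx]|/(_ x)]; last by rewrite eqxx.
  have : (y - x) i ord0 = 0 by apply: nowit; rewrite ?mulmxBr ?Gyx ?subrr // subvecB Ayx subrr.
  by rewrite !mxE => /eqP; rewrite subr_eq0 => /eqP.
have := sec i iA.
have -> : X i = f \o (fun w => h (message_vector X w)).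
  by apply/funext => w /=; rewrite fh mxE.
rewrite cond_entropy_determined.
(* The earlier rewriting also changed the right-hand entropy; it is restored to be evaluated as
   [ln #|F|], which is positive. *)
have -> : f \o (fun w => h (message_vector X w)) = X i.
  by apply/funext => w /=; rewrite fh mxE.
have F1 : (1 < #|F|)%N by apply: card_finNzRing_gt1.
rewrite entropy_uniform ?(ltnW F1) // => /esym/eqP; apply/negP.
by rewrite gt_eqF // ln_gt0 // ltr1n.
Qed.

(** Appended zero rows change neither the kernel nor what can be decoded. Security is passed on as
    witnesses, the form in which codes are combined. *)
Lemma padded_code (K : 'I_m -> {set 'I_m}) (A : {set 'I_m}) l n :
  (l <= n)%N -> secure_code_of_length P X K A l ->
  exists G : 'M[F]_(n, m), decodable K (mulmx G) /\
    forall i, i \notin A ->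
    exists z, [/\ G *m z = 0, subvec A z = 0 & z i ord0 = 1].
Proof.
move=> /subnKC <- [G [dec /weakly_secure_witness wit]].
exists (col_mx G 0); split=> [|i iA].
  apply/decodableP => i x y; rewrite !mul_col_mx => /eq_col_mx[e _].
  by move/decodableP: dec; apply.
have [z [Gz Az zi]] := wit i iA.
by exists z; split=> //; rewrite mul_col_mx Gz mul0mx col_mx0.
Qed.

End LinearCodes.

(** Moves a code for the part [S] back to the original indices. By linearity decoding becomes a
    statement about kernels; a witness extended by 0 also vanishes on the messages of [A] outside
    [S]. *)
Lemma padded_subcode (R : realType) (d : measure_display) (T : measurableType d)
    (P : probability T R) (F : finFieldType) (m : nat) (X : 'I_m -> T -> F)
    (uX : forall i a, pmass P (X i) a = #|F|%:R^-1)
    (K : 'I_m -> {set 'I_m}) (A S : {set 'I_m}) l n :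
  (l <= n)%N -> secure_subcode_of_length P X K A S l ->
  exists G : 'M[F]_(n, #|S|),
    (forall i (x : 'cV[F]_m), i \in S -> G *m subvec S x = 0 ->
       subvec (K i) x = 0 -> x i ord0 = 0) /\
    (forall i, i \in S -> i \notin A -> exists z : 'cV[F]_#|S|,
       [/\ G *m z = 0, subvec A (extend0 z) = 0 & extend0 z i ord0 = 1]).
Proof.
move=> ln /(padded_code (fun k => uX (enum_val k)) ln)[G [/decodableP dec wit]].
exists G; split=> i.
  move=> x iS Gx Kx; have := dec (enum_rank_in iS i) (subvec S x) 0.
  rewrite subvecE enum_rankK_in // mxE; apply; first by rewrite Gx mulmx0.
  apply/eq_subvec => k; rewrite inE => kK.
  by rewrite subvecE mxE (iffLR (subvec_eq0 _ _) Kx).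
move=> iS iA; have [|z [Gz Az zi]] := wit (enum_rank_in iS i).
  by rewrite inE enum_rankK_in.
exists z; split=> //; last by rewrite -zi -extend0E enum_rankK_in.
apply/subvec_eq0 => j jA.
have [jS|/extend0_out -> //] := boolP (j \in S).
rewrite -(enum_rankK_in jS jS) extend0E (iffLR (subvec_eq0 _ _) Az) //.
by rewrite inE enum_rankK_in.
Qed.

(** * Assembly of the two-sender code *)

Lemma two_sender_code (R : realType) (d : measure_display) (T : measurableType d)
    (P : probability T R) (F : finFieldType) (m : nat)
    (X : 'I_m -> T -> F) (hX : iid_uniform P X)
    (K : 'I_m -> {set 'I_m}) (M1 M2 : {set 'I_m}) (hM : M1 :|: M2 = [set: 'I_m])
    (A P1 P2 P12 : {set 'I_m})
    (hP1 : P1 = M1 :\: M2) (hP2 : P2 = M2 :\: M1) (hP12 : P12 = M1 :&: M2)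
    (hfull : [/\ fully_participated K P1 P12, fully_participated K P12 P1,
                 fully_participated K P2 P12 & fully_participated K P12 P2])
    l1 l2 l12 n1 n2 :
  (l1 <= n1)%N -> (l2 <= n2)%N -> (l12 <= n1 + n2)%N ->
  secure_subcode_of_length P X K A P1 l1 ->
  secure_subcode_of_length P X K A P2 l2 ->
  secure_subcode_of_length P X K A P12 l12 ->
  secure_two_sender_code_of_length P X K M1 M2 A (n1 + n2).
Proof.
move=> ln1 ln2 ln12; have [_ uX _] := hX.
move=> /(padded_subcode uX ln1)[G1 [dec1 wit1]].
move=> /(padded_subcode uX ln2)[G2 [dec2 wit2]].
move=> /(padded_subcode uX ln12)[G12 [dec12 wit12]].
have [full1 full1' full2 full2'] := hfull.
have S1 : P1 \subset M1 by rewrite hP1 subsetDl.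
have S2 : P2 \subset M2 by rewrite hP2 subsetDl.
have S121 : P12 \subset M1 by rewrite hP12 subsetIl.
have S122 : P12 \subset M2 by rewrite hP12 subsetIr.
have disj B C : B :&: C = finset.set0 -> [disjoint B & C] by rewrite -setI_eq0 => ->.
have D12 : [disjoint P1 & P2].
  by apply: disj; apply/setP => j; rewrite hP1 hP2 !inE; do 2 case: (_ \in _).
have D1 : [disjoint P1 & P12].
  by apply: disj; apply/setP => j; rewrite hP1 hP12 !inE; do 2 case: (_ \in _).
have D2 : [disjoint P2 & P12].
  by apply: disj; apply/setP => j; rewrite hP2 hP12 !inE; do 2 case: (_ \in _).
have D21 : [disjoint P2 & P1] by rewrite disjoint_sym.
have D1' : [disjoint P12 & P1] by rewrite disjoint_sym.
have D2' : [disjoint P12 & P2] by rewrite disjoint_sym.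
have cover i : [\/ i \in P1, i \in P2 | i \in P12].
  have : i \in M1 :|: M2 by rewrite hM finset.in_setT.
  rewrite hP1 hP2 hP12 !inE.
  by case: (i \in M1); case: (i \in M2) => //= _; [apply: Or33|apply: Or31|apply: Or32].
(* [G12] has [n1 + n2] rows: the upper [n1] go to sender 1, the lower [n2] to sender 2, both of whom
   know [P12]. *)
pose C1 := G1 *m reselect F P1 M1 + usubmx G12 *m reselect F P12 M1.
pose C2 := G2 *m reselect F P2 M2 + dsubmx G12 *m reselect F P12 M2.
have C1E x : C1 *m subvec M1 x = G1 *m subvec P1 x + usubmx G12 *m subvec P12 x.
  by rewrite mulmxDl -!mulmxA !reselectE.
have C2E x : C2 *m subvec M2 x = G2 *m subvec P2 x + dsubmx G12 *m subvec P12 x.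
  by rewrite mulmxDl -!mulmxA !reselectE.
have G12E x : G12 *m x = col_mx (usubmx G12 *m x) (dsubmx G12 *m x).
  by rewrite -mul_col_mx vsubmxK.
exists n1, n2, C1, C2; split=> //.
  apply/decodableP => i x y [e1 e2] eK.
  have : C1 *m subvec M1 (x - y) = 0 by rewrite subvecB mulmxBr e1 subrr.
  have : C2 *m subvec M2 (x - y) = 0 by rewrite subvecB mulmxBr e2 subrr.
  have : subvec (K i) (x - y) = 0 by rewrite subvecB eK subrr.
  rewrite C1E C2E => vK v2 v1.
  (* The difference [x - y] vanishes on every part contained in [K i], so that part drops out of the
     codewords. *)
  have known (S : {set 'I_m}) : (forall j, j \in S -> j \in K i) -> subvec S (x - y) = 0.
    by move=> SK; apply/subvec_eq0 => j /SK; move: j; apply/subvec_eq0.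
  suff : (x - y) i ord0 = 0 by rewrite !mxE => /eqP; rewrite subr_eq0 => /eqP.
  case: (cover i) => iS.
  - by apply: dec1 => //; move: v1; rewrite (known P12) ?mulmx0 ?addr0 // => j; apply: full1.
  - by apply: dec2 => //; move: v2; rewrite (known P12) ?mulmx0 ?addr0 // => j; apply: full2.
  - apply: dec12 => //; move: v1 v2; rewrite G12E.
    rewrite (known P1) => [|j]; last exact: full1'.
    rewrite (known P2) => [|j]; last exact: full2'.
    (* Both halves of the codeword of [P12] are now isolated, and stacking them gives back [G12]. *)
    by rewrite !mulmx0 !add0r => -> ->; rewrite col_mx0.
apply: witness_weakly_secure => // i iA.
suff [z [z1 z2 Az zi]] : exists z, [/\ C1 *m subvec M1 z = 0, C2 *m subvec M2 z = 0,
    subvec A z = 0 & z i ord0 = 1].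
  exists z; split=> // a x.
  have lin S : subvec S (x + a *: z) = subvec S x + a *: subvec S z.
    by apply/colP => k; rewrite !mxE.
  by rewrite !lin !mulmxDr -!scalemxAr z1 z2 !scaler0 !addr0.
(* The extended witness is 0 on the two other parts by disjointness, so only the code of its own
   part acts on it. *)
case: (cover i) => iS.
- have [z [Gz Az zi]] := wit1 i iS iA; exists (extend0 z).
  rewrite C1E C2E subvec_extend0 !(subvec_extend0_disjoint z D1, subvec_extend0_disjoint z D12).
  by rewrite Gz !mulmx0 !addr0.
- have [z [Gz Az zi]] := wit2 i iS iA; exists (extend0 z).
  rewrite C1E C2E subvec_extend0 !(subvec_extend0_disjoint z D2, subvec_extend0_disjoint z D21).
  by rewrite Gz !mulmx0 !addr0.
- have [z [Gz Az zi]] := wit12 i iS iA; exists (extend0 z).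
  rewrite C1E C2E subvec_extend0 !(subvec_extend0_disjoint z D1', subvec_extend0_disjoint z D2').
  move: Gz; rewrite G12E => /eqP; rewrite col_mx_eq0 => /andP[/eqP -> /eqP ->].
  by rewrite !mulmx0 !addr0.
Qed.

(** * Optimal lengths and the bound *)

Lemma min_lengthP (Q : nat -> Prop) (exQ : exists l, Q l) : Q (min_length exQ).
Proof. by rewrite /min_length; case: ex_minnP => l /asboolP. Qed.

Lemma min_length_le (Q : nat -> Prop) (exQ : exists l, Q l) l :
  Q l -> (min_length exQ <= l)%N.
Proof.
by move=> Ql; rewrite /min_length; case: ex_minnP => k _; apply; apply/asboolP.
Qed.


Theorem theorem2 (R : realType) (d : measure_display) (T : measurableType d)
  (P : probability T R) (F : finFieldType) (m : nat)
  (X : 'I_m -> T -> F) (hX : iid_uniform P X)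
  (K : 'I_m -> {set 'I_m}) (hK : forall i, i \notin K i)
  (M1 M2 : {set 'I_m}) (hM : M1 :|: M2 = [set: 'I_m])
  (A : {set 'I_m}) (hA : A \proper [set: 'I_m])
  (P1 P2 P12 : {set 'I_m})
  (hP1 : P1 = M1 :\: M2) (hP2 : P2 = M2 :\: M1) (hP12 : P12 = M1 :&: M2)
  (hcase : case_II_B K P1 P2 P12)
  (hfull : [/\ fully_participated K P1 P12, fully_participated K P12 P1,
               fully_participated K P2 P12 & fully_participated K P12 P2])
  (h1 : exists l, secure_subcode_of_length P X K A P1 l)
  (h2 : exists l, secure_subcode_of_length P X K A P2 l)
  (h12 : exists l, secure_subcode_of_length P X K A P12 l) :
  exists h : (exists l, secure_two_sender_code_of_length P X K M1 M2 A l),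
    (min_length h <= maxn (min_length h12) (min_length h1 + min_length h2))%N.
Proof.
set N := maxn _ _.
suff c : secure_two_sender_code_of_length P X K M1 M2 A N.
  by exists (ex_intro _ N c); apply: min_length_le.
have le12 : (min_length h1 + min_length h2 <= N)%N by apply: leq_maxr.
have le2 : (min_length h2 <= N)%N by apply: leq_trans le12; apply: leq_addl.
(* Sender 2 gets exactly its optimal length and sender 1 the rest of [N], which is at least
   [min_length h1]; all the padding falls on sender 1 and on [P12]. *)
rewrite -(subnK le2).
apply: (two_sender_code hX hM hP1 hP2 hP12 hfull) (min_lengthP h1) (min_lengthP h2)
  (min_lengthP h12) => //; first by rewrite leq_subRL // addnC.
by rewrite subnK // leq_maxl.
Qed.
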